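(* Let $A$ be a two-sided skew brace. Then the following are equivalent: (1) $(A,+)$ satisfies the maximum condition on subgroups; (2) $(A,\circ)$ satisfies the maximum condition on subgroups.
   Context: A skew (left) brace is a triple $(A,+,\circ)$ such that $(A,+)$ and $(A,\circ)$ are (not necessarily abelian) groups and $a\circ(b+c)=a\circ b-a+a\circ c$ for all $a,b,c\in A$. It is two-sided if moreover $(a+b)\circ c=a\circ c-c+b\circ c$ for all $a,b,c\in A$. A group satisfies the maximum condition on subgroups if there exists no infinite strictly ascending chain of subgroups. *)

(* Defs.v *)
From HB Require Import structures.
From mathcomp Require Import all_boot.
From mathcomp Require Import boolp classical_sets.

Set Implicit Arguments.
Unset Strict Implicit.
Unset Printing Implicit Defensive.

Local Open Scope classical_set_scope.

(* [hadd a b], [hopp a] and [circ a b] stand for a + b, - a and a o b;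
   neither group is assumed to be commutative. *)
Record skewBrace := SkewBrace {
  carrier :> Type;
  hzero : carrier;
  hopp : carrier -> carrier;
  hadd : carrier -> carrier -> carrier;
  haddA : associative hadd;
  hadd0b : left_id hzero hadd;
  haddb0 : right_id hzero hadd;
  haddNb : left_inverse hzero hopp hadd;
  haddbN : right_inverse hzero hopp hadd;
  cone : carrier;
  cinv : carrier -> carrier;
  circ : carrier -> carrier -> carrier;
  circA : associative circ;
  circ1b : left_id cone circ;
  circb1 : right_id cone circ;
  circVb : left_inverse cone cinv circ;
  circbV : right_inverse cone cinv circ;
  circDr : forall a b c : carrier,
    circ a (hadd b c) = hadd (hadd (circ a b) (hopp a)) (circ a c)
}.

Definition two_sided (A : skewBrace) : Prop :=
  forall a b c : A,
    circ (hadd a b) c = hadd (hadd (circ a c) (hopp c)) (circ b c).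

(* A type carries at most one canonical groupType structure, so (A,+) and
   (A,o) are attached to two copies of the carrier.  MathComp's groups are
   multiplicative: in [add_group A], [x * y] is x + y. *)
Definition add_group (A : skewBrace) : Type := A.
Definition circ_group (A : skewBrace) : Type := A.

HB.instance Definition _ (A : skewBrace) := gen_eqMixin (add_group A).
HB.instance Definition _ (A : skewBrace) := gen_choiceMixin (add_group A).
HB.instance Definition _ (A : skewBrace) := isGroup.Build (add_group A)
  (@haddA A) (@hadd0b A) (@haddb0 A) (@haddNb A) (@haddbN A).

HB.instance Definition _ (A : skewBrace) := gen_eqMixin (circ_group A).
HB.instance Definition _ (A : skewBrace) := gen_choiceMixin (circ_group A).
HB.instance Definition _ (A : skewBrace) := isGroup.Build (circ_group A)
  (@circA A) (@circ1b A) (@circb1 A) (@circVb A) (@circbV A).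

Definition is_subgroup (G : groupType) (H : set G) : Prop :=
  group_closed (mem H).

Definition max_subgroups (G : groupType) : Prop :=
  ~ exists H : nat -> set G,
      (forall n, is_subgroup (H n)) /\ (forall n, H n `<` H n.+1).

(* Main.v *)
Require Import Defs.
From HB Require Import structures.
From mathcomp Require Import all_boot all_order all_algebra ring.
From mathcomp Require Import boolp classical_sets.

(**
Put [a * b = - a + a ∘ b - b]. Expanding [(a + b) * (c + d)] in two ways shows
that [- c + b ∘ c - b] commutes additively with every [a * d]. Let [S] be the
additive subgroup generated by the [a * d], and [C] its additive centre; both
are ideals. Modulo [S] the two operations agree; on [S] modulo [C],
[b ∘ c = c + b]; and [C] is a radical ring under [+] and [*]. As the maximum
condition passes to extensions, only the case of a radical ring [R] remains.

There, either maximum condition bounds the left ideals. If every element of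
[R] is nilpotent, Utumi's argument provides, above any proper ideal [I], a
larger ideal [J] with [J * J <= I]; modulo [I] the two operations agree on [J],
so a maximal ideal among those satisfying the desired condition is [R] itself.

For nilpotency, let [w_0 = X], [w_(n+1) = w_n (1 + w_n)], so that the
[u_n = 1 + w_n] are pairwise comaximal in [Z[X]]. For every [b] in [R], either
maximum condition yields [n] and [f] with [b (u_n(b) f(b) - 1) = 0]. The
polynomial [X (u_n f - 1)] vanishes modulo no prime, and at no positive integer.
Given [a], splitting off the lowest coefficient [c] of the polynomial obtained
for [a] gives [c a^j = b a^j] with [b] in [R] and [c] a nonzero integer, and
then the relation for [b] shows that [a^j] is torsion. Its order is removed
prime by prime: if [p y = 0], the lowest coefficient prime to [p] gives
[a^i y = b a^i y] with [b] in [R], whence [a^i y = 0].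
*)

Set Implicit Arguments.
Unset Strict Implicit.
Unset Printing Implicit Defensive.

Import Order.TTheory GRing.Theory Num.Theory.
Local Open Scope classical_set_scope.

(** * Chain conditions on intervals of subgroups *)

Definition acc T (P : set (set T)) : Prop :=
  forall H : nat -> set T, (forall n, P (H n)) ->
    (forall n, H n `<=` H n.+1) ->
  exists n, forall m, n <= m -> H m `<=` H n.

Lemma chain_le T (H : nat -> set T) (Hs : forall n, H n `<=` H n.+1) m n :
  m <= n -> H m `<=` H n.
Proof.
move=> /subnK <-; elim: (n - m) => [|k IH] //.
by rewrite addSn; apply: subset_trans IH (Hs _).
Qed.

Lemma acc_sub T (P Q : set (set T)) : P `<=` Q -> acc Q -> acc P.
Proof. by move=> PQ accQ H PH; apply: accQ => n; apply: PQ. Qed.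

(** If a chain never stabilizes, every index has a later one at which the set has grown; iterating
    this choice extracts a strict subchain. *)
Lemma acc_strict T (P : set (set T)) :
  acc P <-> ~ exists H : nat -> set T,
    (forall n, P (H n)) /\ (forall n, H n `<` H n.+1).
Proof.
split=> [accP [H [PH Hs]]|noH H PH Hs].
  have [n /(_ n.+1 (leqnSn n))] := accP H PH (fun n => (Hs n).1).
  exact: (Hs n).2.
apply: contrapT => nstab; apply: noH.
have /choice[f fP] n : exists m, n <= m /\ ~ H m `<=` H n.
  apply: contrapT => nex; apply: nstab; exists n => m nm.
  by apply: contrapT => nH; apply: nex; exists m.
exists (fun n => H (iter n f 0)); split=> // n; split=> /=.
  by apply: chain_le => //; case: (fP (iter n f 0)).
by case: (fP (iter n f 0)).
Qed.

Lemma acc_max T (P F : set (set T)) (H0 : set T) :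
    acc P -> F `<=` P -> F H0 ->
  exists2 M, F M & forall K, F K -> M `<=` K -> K `<=` M.
Proof.
move=> accP FP F0; apply: contrapT => nomax.
have up (M : {H | F H}) : {K : {H | F H} | sval M `<` sval K}.
  apply: cid; apply: contrapT => nK; apply: nomax.
  exists (sval M); first exact: svalP.
  move=> K FK MK; apply: contrapT => nKM; apply: nK.
  by exists (exist _ K FK); split.
pose c n := iter n (fun M => sval (up M)) (exist _ H0 F0).
apply: (acc_strict P).1 accP _; exists (fun n => sval (c n)).
by split=> n; [apply/FP/svalP | rewrite /c /=; case: (up _)].
Qed.

Section Intervals.
Variable G : groupType.
Implicit Types H K L M N : set G.
Local Open Scope group_scope.

Lemma is_subgroupP H : is_subgroup H <->
  H 1 /\ forall x y, H x -> H y -> H (x * y^-1).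
Proof.
rewrite /is_subgroup /group_closed /divg_closed.
split=> [[H1 HD]|[H1 HD]]; split.
- by move: H1; rewrite inE.
- by move=> x y Hx Hy; have := HD x y; rewrite !inE => /(_ Hx Hy).
- by rewrite inE.
- by move=> x y; rewrite !inE; exact: HD.
Qed.

Lemma subgroup1 H : is_subgroup H -> H 1.
Proof. by case/is_subgroupP. Qed.

Lemma subgroupV H x : is_subgroup H -> H x -> H x^-1.
Proof. by case/is_subgroupP => H1 HD Hx; rewrite -[x^-1]mul1g; apply: HD. Qed.

Lemma subgroupM H x y : is_subgroup H -> H x -> H y -> H (x * y).
Proof.
move=> sH Hx Hy; rewrite -[y]invgK; case/is_subgroupP: (sH) => _ HD.
by apply: HD => //; apply: subgroupV.
Qed.

Lemma subgroup_intro H : H 1 -> (forall x y, H x -> H y -> H (x * y)) ->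
  (forall x, H x -> H x^-1) -> is_subgroup H.
Proof.
by move=> H1 HM HV; apply/is_subgroupP; split=> // x y Hx Hy; apply/HM/HV.
Qed.

(** For [L] normal in [M] these correspond to the subgroups of [M / L], so conditions on quotients
    are expressed without forming them. *)
Definition between L M : set (set G) :=
  [set H | [/\ is_subgroup H, L `<=` H & H `<=` M]].

Lemma max_subgroupsE : max_subgroups G <-> acc (between [set 1] setT).
Proof.
apply: iff_trans (iff_sym (acc_strict _)).
split=> noH [H [PH Hs]]; apply: noH; exists H; split=> // n.
  by case: (PH n).
by split=> // x ->; apply: subgroup1.
Qed.

Lemma between_sub L M L' M' : L `<=` L' -> M' `<=` M ->
  between L' M' `<=` between L M.
Proof.
move=> LL MM H [sH LH HM]; split=> //; first exact: subset_trans LH.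
exact: subset_trans MM.
Qed.

(* By the modular law, [H] is determined by [H :&: N] and [H * N] within any
   chain of subgroups. *)
Lemma acc_extension L N M :
    is_subgroup N -> L `<=` N -> N `<=` M ->
    is_subgroup M -> (forall m x, M m -> N x -> N (m * x * m^-1)) ->
  acc (between L N) -> acc (between N M) -> acc (between L M).
Proof.
move=> sN LN NM sM nN accN accM H PH Hs.
have sH n : is_subgroup (H n) by case: (PH n).
have HM n x : H n x -> M x by case: (PH n) => _ _; apply.
have [n1 st1] : exists n, forall m, n <= m -> H m `&` N `<=` H n `&` N.
  apply: (accN (fun n => H n `&` N)) => n; last first.
    by move=> x [Hx Nx]; split=> //; apply: Hs.
  split=> [|x Lx|x []//]; last by split; [case: (PH n) => _ + _; apply | apply: LN].
  apply: subgroup_intro.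
  - by split; apply: subgroup1.
  - by move=> x y [? ?] [? ?]; split; apply: subgroupM.
  - by move=> x [? ?]; split; apply: subgroupV.
pose P n : set G := [set z | exists x y, [/\ H n x, N y & z = x * y]].
have [n2 st2] : exists n, forall m, n <= m -> P m `<=` P n.
  apply: (accM P) => n; last first.
    by move=> _ [x [y [Hx Ny ->]]]; exists x, y; split=> //; apply: Hs.
  split.
  - apply: subgroup_intro.
    + by exists 1, 1; rewrite mulg1; split=> //; apply: subgroup1.
    + move=> _ _ [x [y [Hx Ny ->]]] [x' [y' [Hx' Ny' ->]]].
      exists (x * x'), ((x'^-1 * y * x'^-1^-1) * y'); split.
      * exact: subgroupM.
      * by apply: subgroupM => //; apply: nN => //; apply: HM (subgroupV _ Hx').
      * by rewrite invgK !mulgA mulgK.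
    + move=> _ [x [y [Hx Ny ->]]]; exists x^-1, (x * y^-1 * x^-1); split.
      * exact: subgroupV.
      * by apply: nN; [apply: HM Hx | apply: subgroupV].
      * by rewrite invgM !mulgA mulVg mul1g.
  - move=> y Ny; exists 1, y; rewrite mul1g; split=> //; exact: subgroup1.
  - move=> _ [x [y [Hx Ny ->]]]; apply: subgroupM => //; first exact: HM Hx.
    exact: NM.
exists (maxn n1 n2) => m nm x Hx.
have /st2-/(_ (leq_trans (leq_maxr _ _) nm)) [h [y [Hh Ny xE]]] : P m x.
  by exists x, 1; rewrite mulg1; split=> //; apply: subgroup1.
have Hn : H (maxn n1 n2) h by apply: chain_le Hh => //; apply: leq_maxr.
rewrite xE; apply: subgroupM => //.
suff : (H n1 `&` N) y by case=> + _; apply: chain_le => //; apply: leq_maxl.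
apply: (st1 m); first exact: leq_trans (leq_maxl _ _) nm.
split=> //; have -> : y = h^-1 * x by rewrite xE mulKg.
apply: subgroupM => //; apply: subgroupV => //; exact: chain_le Hn.
Qed.

End Intervals.

(** * Nilpotency from polynomial relations *)

Section Sylvester.
Local Open Scope ring_scope.

(** At [c = 1] the values of [1 + sylvester c n] are Sylvester's sequence 2, 3, 7, 43. *)
Fixpoint sylvester (R : nzRingType) (c : R) n : R :=
  if n is m.+1 then sylvester c m * (1 + sylvester c m) else c.

Lemma sylvesterS (R : nzRingType) (c : R) n :
  sylvester c n.+1 = sylvester c n * (1 + sylvester c n).
Proof. by []. Qed.

Lemma rmorph_sylvester (R S : nzRingType) (f : {rmorphism R -> S}) c n :
  f (sylvester c n) = sylvester (f c) n.
Proof. by elim: n => //= n IH; rewrite rmorphM rmorphD rmorph1 IH. Qed.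

(** For [i < n] the factor [1 + w_i] divides [w_n], so [1 + w_n] is 1 modulo [1 + w_i]. Comaximality
    then passes to powers and products. *)
Lemma sylvester_comaximal (R : comNzRingType) (c : R) (e : nat -> nat) n :
  exists a b, a * (1 + sylvester c n)
    + b * \prod_(i < n) (1 + sylvester c i) ^+ e i = 1.
Proof.
have dvd_syl i k : exists z, sylvester c (i.+1 + k)%N = (1 + sylvester c i) * z.
  elim: k => [|k [z IH]]; first by exists (sylvester c i); rewrite addn0 sylvesterS mulrC.
  by rewrite addnS sylvesterS IH -mulrA; eexists.
elim/big_ind: _ => [|x y [a [b xE]] [a' [b' yE]]|i _].
- by exists 0, 1; rewrite mul0r mul1r add0r.
- exists (a + b * x * a'), (b * b').
  set u := 1 + _ in xE yE *; transitivity (a * u + b * x * (a' * u + b' * y)).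
    by ring.
  by rewrite yE mulr1.
- have [z zE] := dvd_syl i (n - i.+1)%N.
  have {}zE : sylvester c n = (1 + sylvester c i) * z by rewrite -zE subnKC.
  elim: (e i) => [|k [a [b kE]]]; first by exists 0, 1; rewrite mul0r mul1r add0r.
  exists (a + b * (1 + sylvester c i) ^+ k), (- b * z).
  by rewrite -[RHS]kE zE exprSr; ring.
Qed.

Lemma sylvester_int_gt0 (c : int) n : 0 < c -> 0 < sylvester c n.
Proof. by move=> c0; elim: n => //= n IH; rewrite mulr_gt0 // addr_gt0. Qed.

Lemma sylvester_polyX_size (F : fieldType) n :
  (1 < size (sylvester ('X : {poly F}) n))%N.
Proof.
elim: n => [|n IH] /=; first by rewrite size_polyX.
set w := sylvester _ n in IH *.
have sz : size (1 + w) = size w by rewrite addrC size_polyDl ?size_poly1.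
rewrite size_mul -?size_poly_gt0 ?sz; last 2 first.
- exact: ltnW.
- exact: ltnW.
by case: (size w) IH => [|[|k]] //; rewrite addnS /= addSn ltnS addnS.
Qed.

End Sylvester.

(** * Nilpotency of quasi-regular elements satisfying integer polynomial relations *)

Section Nilpotence.
Local Open Scope ring_scope.
Variables (E : nzRingType) (J : set E).
Hypothesis (JMl : forall x y, J y -> J (x * y)).
Hypothesis (Jrad : forall x, J x -> exists y, y * (1 + x) = 1).

Lemma intr_comm (b : E) : commr_rmorph (@intmul E 1) b.
Proof. by move=> x; apply: commr_int. Qed.

(** A ring morphism even for noncommutative [E], because integers commute with [b]. *)
Definition int_eval (b : E) : {rmorphism {poly int} -> E} :=
  horner_morph (intr_comm b).

Arguments int_eval : simpl never.

Lemma int_evalX b : int_eval b 'X = b.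
Proof. exact: horner_morphX. Qed.

Lemma int_evalC b c : int_eval b c%:P = c%:~R.
Proof. exact: horner_morphC. Qed.

(** A Nakayama-type cancellation: [1 - x] is left invertible and kills [y]. *)
Lemma rad_fix x y : J x -> y = x * y -> y = 0.
Proof.
move=> Jx xy; have [|v vE] := Jrad (x := - x).
  by rewrite -mulN1r; apply: JMl.
by rewrite -[y]mul1r -vE -mulrA mulrDl mul1r mulNr -xy subrr mulr0.
Qed.

Definition sylvester_root b := exists n f,
  b * int_eval b ((1 + sylvester 'X n) * f - 1) = 0.

Hypothesis Hroot : forall b, J b -> sylvester_root b.

Definition root_poly n (f : {poly int}) : {poly int} :=
  'X * ((1 + sylvester 'X n) * f - 1).

(** Vanishing modulo [p] would make the nonconstant polynomial [1 + w_n] a unit over the field with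
    [p] elements. *)
Lemma root_poly_primitive n f p : prime p -> exists i, ~~ (p %| (root_poly n f)`_i)%Z.
Proof.
move=> pr_p; apply: contrapT => Hn.
have dvd i : (p %| (root_poly n f)`_i)%Z.
  by apply: contrapT => /negP Hi; apply: Hn; exists i.
have : map_poly (intr : int -> 'F_p) (root_poly n f) = 0.
  apply/polyP => i; rewrite coef_map coef0 /=.
  have /dvdzP[q ->] := dvd i; rewrite intrM -[p%:~R]/(p%:R).
  by rewrite pchar_Fp_0 // mulr0.
rewrite rmorphM /= map_polyX => /eqP; rewrite mulf_eq0 polyX_eq0 /=.
rewrite rmorphB rmorph1 rmorphM /= rmorphD rmorph1 rmorph_sylvester /= map_polyX.
rewrite subr_eq0 => /eqP /(congr1 (size \o polyseq)) /=.
set u := 1 + _; set g := map_poly _ _ => szE.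
have su : (1 < size u)%N.
  by rewrite /u addrC size_polyDl ?size_poly1 ?sylvester_polyX_size.
move/eqP: szE; rewrite size_poly1 size_mul_eq1 => /andP[/eqP s1 _].
by rewrite s1 in su.
Qed.

(** A zero at [c] would make the integer [1 + sylvester c n], which exceeds 1, a unit. *)
Lemma root_poly_pos n f (c : int) : 0 < c -> (root_poly n f).[c] != 0.
Proof.
move=> c0; rewrite /root_poly hornerM hornerX; apply: mulf_neq0; first by rewrite gt_eqF.
rewrite hornerD hornerN hornerC hornerM subr_eq0; apply/negP => /eqP uf.
have uE : (1 + sylvester 'X n).[c] = 1 + sylvester c n.
  rewrite -horner_evalE rmorphD rmorph1 rmorph_sylvester /=.
  by rewrite /horner_eval hornerX.
have : (1 + sylvester 'X n).[c] \is a GRing.unit.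
  by apply/unitrPr; exists f.[c].
rewrite uE; have w0 := sylvester_int_gt0 n c0.
rewrite -[_ \is a _]/((_ == 1) || (_ == -1)) => /orP[/eqP u1|/eqP u1].
  by rewrite -(ltrDl 1) u1 ltxx in w0.
by have := addr_gt0 (ltr01 : 0 < 1 :> int) w0; rewrite u1.
Qed.

(** The terms of degree below [i] kill [y], and those above contribute a multiple of [a] times
    [a ^+ i * y]; left multiples of [a] stay in [J]. *)
Lemma rad_lowest_coef a y (Q : {poly int}) i :
    J a -> int_eval a Q * y = 0 -> (forall k, (k < i)%N -> (Q`_k)%:~R * y = 0) ->
  exists2 b, J b & (Q`_i)%:~R * (a ^+ i * y) = b * (a ^+ i * y).
Proof.
move=> Ja Q0 low; exists (- (int_eval a (drop_poly i.+1 Q) * a)).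
  by rewrite -mulN1r; apply: JMl; apply: JMl.
have dropS : drop_poly i Q = (Q`_i)%:P + drop_poly i.+1 Q * 'X.
  by apply/polyP => -[|k]; rewrite coefD coefC coefMX !coef_drop_poly /= ?addr0 ?add0r
    ?add0n // addSnnS.
apply/eqP; rewrite mulNr -addr_eq0; apply/eqP.
rewrite -{}[RHS]Q0 -[in RHS](poly_take_drop i Q) dropS rmorphD /= mulrDl.
rewrite [X in _ = X + _](_ : _ = 0) ?add0r.
  by rewrite !(rmorphM, rmorphD, rmorphXn) /= int_evalC int_evalX -mulrDl mulrA.
rewrite -[take_poly i Q]coefK poly_def rmorph_sum /= mulr_suml big1 // => k _.
rewrite -mul_polyC rmorphM /= rmorphXn int_evalC int_evalX -commr_int -mulrA.
rewrite coef_take_poly; case: ifP => ki; first by rewrite low ?mulr0.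
by rewrite mul0r mulr0.
Qed.

Lemma int_eval_eigen b x (c : int) f : b * x = c%:~R * x ->
  int_eval b f * x = f.[c]%:~R * x.
Proof.
move=> bx; elim/poly_ind: f => [|f k IH]; first by rewrite rmorph0 horner0 mul0r.
rewrite rmorphD rmorphM /= int_evalX int_evalC mulrDl -mulrA bx.
rewrite mulrA commr_int -mulrA IH hornerD hornerMX hornerC intrD mulrDl.
by rewrite [_ * (_ * x)]mulrA -intrM [c * _]mulrC.
Qed.

Lemma rad_torsion_nilpotent a m i : J a -> (0 < m)%N -> m%:R * a ^+ i = 0 ->
  exists k, a ^+ k = 0.
Proof.
move=> Ja; have [n [f Qa]] := Hroot Ja.
have {}Qa : int_eval a (root_poly n f) = 0 by rewrite rmorphM /= int_evalX.
elim/ltn_ind: m i => m IH i m0 ma.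
have [m1|m1] := leqP m 1.
  exists i; have m1E : m = 1%N by case: m m0 m1 {IH ma} => [|[]].
  by rewrite m1E mul1r in ma.
have pr_p := pdiv_prime m1; set p := pdiv m in pr_p.
have pm : (p %| m)%N := pdiv_dvd m.
have [j pj jmin] := ex_minnP (root_poly_primitive n f pr_p).
pose y := (m %/ p)%:R * a ^+ i.
have py : p%:R * y = 0 by rewrite mulrA -natrM mulnC divnK.
have [|k kj|b Jb by_] := @rad_lowest_coef a y (root_poly n f) j Ja.
- by rewrite Qa mul0r.
- have /negbNE/dvdzP[q ->] : ~~ ~~ (p %| (root_poly n f)`_k)%Z.
    by apply/negP => /jmin; rewrite leqNgt kj.
  by rewrite intrM -mulrA py mulr0.
have /coprimezP[[u v] /= uv] : coprimez (root_poly n f)`_j p.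
  by rewrite coprimez_sym coprimezE prime_coprime // -dvdzE.
(* By Bezout, [u] times the [j]-th coefficient acts as 1 on [a ^+ j * y], which [p] kills; hence
   [u * b] fixes this element. *)
have ay0 : a ^+ j * y = 0.
  apply: (@rad_fix (u%:~R * b)); first exact: JMl.
  rewrite -mulrA -by_ [u%:~R * _]mulrA -intrM -[LHS]mul1r -[1 in LHS]/((1 : int)%:~R) -uv.
  rewrite intrD mulrDl [X in _ + X](_ : _ = 0) ?addr0 //.
  by rewrite intrM -mulrA -pmulrn [p%:R * _]mulrA -commr_nat -mulrA py !mulr0.
apply: (IH (m %/ p)%N _ (j + i)%N).
- exact: ltn_Pdiv (prime_gt1 pr_p) m0.
- by rewrite divn_gt0 ?prime_gt0 // dvdn_leq.
- by rewrite exprD mulrA -commr_nat -mulrA.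
Qed.

Lemma rad_nilpotent a : J a -> exists k, a ^+ k = 0.
Proof.
move=> Ja; have [n [f Qa]] := Hroot Ja.
have [j Qj jmin] : exists2 j, (root_poly n f)`_j != 0 &
    forall k, (k < j)%N -> (root_poly n f)`_k = 0.
  have ex : exists i, (root_poly n f)`_i != 0.
    (* Any prime serves here: a coefficient not divisible by it is nonzero. *)
    have [i Hi] := root_poly_primitive n f (isT : prime 2).
    by exists i; apply: contraNneq Hi => ->; rewrite dvdz0.
  have [j Qj jmin] := ex_minnP ex; exists j => // k kj; apply/eqP/negbNE/negP.
  by move/jmin; rewrite leqNgt kj.
have [||b Jb] := @rad_lowest_coef a 1 (root_poly n f) j Ja.
- by rewrite mulr1 rmorphM /= int_evalX.
- by move=> k /jmin ->; rewrite mul0r.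
rewrite mulr1 => ba.
(* A change of sign makes the eigenvalue positive, as [root_poly_pos] requires. *)
have {b Jb ba Qj} [c [b [c0 Jb ba]]] : exists c b, [/\ 0 < c, J b &
    b * a ^+ j = c%:~R * a ^+ j].
  have [c0|c0|/eqP] := ltgtP (root_poly n f)`_j 0; last by rewrite (negPf Qj).
    exists (- (root_poly n f)`_j), (- b); rewrite oppr_gt0 mulrNz !mulNr ba.
    by split=> //; rewrite -mulN1r; apply: JMl.
  by exists (root_poly n f)`_j, b.
have [m [g Qb]] := Hroot Jb.
have {}Qb : int_eval b (root_poly m g) = 0 by rewrite rmorphM /= int_evalX.
(* On the eigenvector [a ^+ j] of [b], the relation for [b] becomes multiplication by a nonzero
   integer. *)
have := int_eval_eigen (root_poly m g) ba; rewrite Qb mul0r => /esym Na.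
have := root_poly_pos m g c0; set N := _.[c] in Na *; move=> N0.
apply: (@rad_torsion_nilpotent a `|N|%N j) => //; first by rewrite absz_gt0.
have [s ->] : exists s : int, `|N|%N%:R = s%:~R * N%:~R :> E.
  by exists (sgz N); rewrite -intrM -abszEsg pmulrn.
by rewrite -mulrA Na mulr0.
Qed.

End Nilpotence.

(** * Skew braces and radical rings *)

Declare Scope brace_scope.
Delimit Scope brace_scope with brace.
Local Notation "0" := (hzero _) : brace_scope.
Local Notation "x + y" := (hadd x y) : brace_scope.
Local Notation "- x" := (hopp x) : brace_scope.
Local Notation "x - y" := (hadd x (hopp y)) : brace_scope.
Local Notation "x ∘ y" := (circ x y) (at level 40, left associativity) : brace_scope.

(** The usual action of [(A, ∘)] on [(A, +)] by automorphisms; see [lamD] and [lam_circ]. *)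
HB.lock Definition lam (A : skewBrace) (a b : A) : A := (- a + a ∘ b)%brace.
HB.lock Definition star (A : skewBrace) (a b : A) : A := (lam a b - b)%brace.

Section Brace.
Variable A : skewBrace.
Implicit Types (a b c d x y : A) (H N M : set A).
Local Open Scope brace_scope.

Lemma haddK x y : x + y - y = x. Proof. exact: (@mulgK (add_group A)). Qed.
Lemma haddNK x y : x - y + y = x. Proof. exact: (@mulgVK (add_group A)). Qed.
Lemma haddKl x y : - x + (x + y) = y. Proof. exact: (@mulKg (add_group A)). Qed.
Lemma haddNKl x y : x + (- x + y) = y. Proof. exact: (@mulVKg (add_group A)). Qed.
Lemma hoppK x : - - x = x. Proof. exact: (@invgK (add_group A)). Qed.
Lemma hoppD x y : - (x + y) = - y - x. Proof. exact: (@invgM (add_group A)). Qed.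
Lemma haddI x y z : x + y = x + z -> y = z.
Proof. exact: (@mulgI (add_group A)). Qed.
Lemma haddIr x y z : y + x = z + x -> y = z.
Proof. exact: (@mulIg (add_group A)). Qed.

Lemma circb0 a : a ∘ 0 = a.
Proof.
have := circDr a 0 0; rewrite hadd0b -{1}(hadd0b (a ∘ 0)) => /haddIr aE.
by rewrite -(haddNK (a ∘ 0) a) -aE hadd0b.
Qed.

Lemma cone0 : cone A = 0.
Proof. by rewrite -[LHS]circb0 circ1b. Qed.


Lemma circE a b : a ∘ b = a + lam a b.
Proof. by rewrite lam.unlock haddNKl. Qed.

Lemma lam_star a b : lam a b = star a b + b.
Proof. by rewrite star.unlock haddNK. Qed.

Lemma circE_star a b : a ∘ b = a + star a b + b.
Proof. by rewrite circE lam_star haddA. Qed.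

Lemma lamD a b c : lam a (b + c) = lam a b + lam a c.
Proof. by rewrite lam.unlock circDr !haddA. Qed.

Lemma lam1 b : lam (cone A) b = b.
Proof. by rewrite lam.unlock circ1b cone0 -{1}(hadd0b b) haddKl. Qed.

Lemma lam_circ a b c : lam (a ∘ b) c = lam a (lam b c).
Proof.
apply: (@haddI (a ∘ b)); rewrite -circE -circA (circE b c) circDr.
by rewrite (circE a (lam b c)) haddA haddNK.
Qed.

Lemma lamKV a b : lam a (lam (cinv a) b) = b.
Proof. by rewrite -lam_circ circbV lam1. Qed.

Lemma add_circ x y : x + y = x ∘ lam (cinv x) y.
Proof. by rewrite circE lamKV. Qed.

Lemma starDr a b c : star a (b + c) = star a b + (b + star a c - b).
Proof. by rewrite star.unlock lamD hoppD !haddA haddNK. Qed.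

Lemma circ_subgroup_intro H : H 0 -> (forall x y, H x -> H y -> H (x ∘ y)) ->
  (forall x, H x -> H (cinv x)) -> @is_subgroup (circ_group A) H.
Proof.
move=> H0 HM HV; apply: (@subgroup_intro (circ_group A)) => //.
by rewrite -[X in H X]/(cone A) cone0.
Qed.

(* With [rev] set, the roles are played by [circ] and the opposite of [hadd],
   which has the same subgroups as [hadd]. *)
Lemma between_add_circ (rev : bool) N M :
    @is_subgroup (add_group A) N -> (forall a x, N x -> N (lam a x)) ->
    @is_subgroup (add_group A) M -> @is_subgroup (circ_group A) M ->
    (forall b c, M b -> M c ->
       exists2 n, N n & b ∘ c = (if rev then c + b else b + c) + n) ->
  @between (add_group A) N M = @between (circ_group A) N M.
Proof.
move=> sN lN sM sM' near; apply/seteqP; split=> H [sH NH HM]; split=> //.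
  have HD := @subgroupM (add_group A) _ _ _ sH.
  have HN := @subgroupV (add_group A) _ _ sH.
  apply: circ_subgroup_intro.
  - exact: subgroup1 sH.
  - move=> b c Hb Hc; have [n Nn ->] := near b c (HM _ Hb) (HM _ Hc).
    by apply: (HD _ _ _ (NH _ Nn)); case: rev {near}; apply: HD.
  - move=> b Hb; have [|n Nn] := near b (cinv b) (HM _ Hb).
      exact: (@subgroupV (circ_group A) _ _ sM' (HM _ Hb)).
    rewrite circbV cone0; case: rev {near} => bn.
      have -> : cinv b = - n - b.
        by apply: (@haddIr b); rewrite haddNK; apply: (@haddIr n); rewrite -bn haddNb.
      by apply: (HD _ _); apply: (HN _) => //; apply: NH.
    have -> : cinv b = - b - n.
      by apply: (@haddI b); rewrite haddNKl; apply: (@haddIr n); rewrite -bn haddNb.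
    by apply: (HD _ _); apply: (HN _) => //; apply: NH.
have HC := @subgroupM (circ_group A) _ _ _ sH.
have HV := @subgroupV (circ_group A) _ _ sH.
have HP b c : H b -> H c -> H (if rev then c + b else b + c).
  move=> Hb Hc; have [n Nn bc] := near b c (HM _ Hb) (HM _ Hc).
  have -> : (if rev then c + b else b + c) = (b ∘ c) - n by rewrite bc haddK.
  (* Adding [- n] amounts to a [∘]-multiplication by an element of [N], since [lam] preserves
     [N]. *)
  rewrite add_circ; apply: (HC _ _); first exact: HC.
  by apply/NH/lN/(@subgroupV (add_group A) _ _ sN).
apply: subgroup_intro.
- by apply: NH; apply: subgroup1 sN.
- by move=> b c Hb Hc; case: rev HP {near} => HP; [apply: (HP c b)|apply: (HP b c)].
- move=> b Hb; have [|n Nn] := near b (- b) (HM _ Hb).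
    exact: (@subgroupV (add_group A) _ _ sM (HM _ Hb)).
  have -> : (if rev then - b + b else b - b) = 0.
    by case: rev {near HP}; rewrite ?haddNb ?haddbN.
  rewrite hadd0b => bn; have -> : (b : add_group A)^-1%g = cinv b ∘ n.
    by rewrite -bn circA circVb circ1b.
  by apply: (HC _ _); [apply: HV | apply: NH].
Qed.

End Brace.

(** * Radical rings as two-sided skew braces with commutative addition *)

Record radicalRing := RadicalRing {
  rbrace :> skewBrace;
  raddC : commutative (@hadd rbrace);
  rtwo_sided : two_sided rbrace
}.

Definition rsort (R : radicalRing) : Type := R.
HB.instance Definition _ (R : radicalRing) := gen_eqMixin (rsort R).
HB.instance Definition _ (R : radicalRing) := gen_choiceMixin (rsort R).
HB.instance Definition _ (R : radicalRing) := GRing.isZmodule.Build (rsort R)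
  (@haddA R) (@raddC R) (@hadd0b R) (@haddNb R).

Definition rmul (R : radicalRing) (x y : rsort R) : rsort R := @star R x y.
Local Notation "x ∗ y" := (rmul x y) (at level 40, left associativity).

Section RadicalRing.
Variable R : radicalRing.
Implicit Types (x y z : rsort R).
Local Open Scope ring_scope.


Lemma rmulE x y : x ∗ y = star x y.
Proof. by []. Qed.

Lemma rcircE x y : circ x y = x + y + x ∗ y :> rsort R.
Proof. by rewrite rmulE (circE_star x y) -[RHS]addrA [y + _]addrC addrA. Qed.

Lemma rmulDr x y z : x ∗ (y + z) = x ∗ y + x ∗ z.
Proof.
rewrite !rmulE [LHS](starDr x y z) -[RHS]/(_ + _)%brace; congr (hadd _ _).
by rewrite -[LHS]/(y + (star x z : rsort R) - y) addrC addKr.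
Qed.

Lemma rmulDl x y z : (x + y) ∗ z = x ∗ z + y ∗ z.
Proof.
have : x + y + z + (x + y) ∗ z = (x + z + x ∗ z) - z + (y + z + y ∗ z).
  by rewrite -!rcircE; apply: rtwo_sided.
move/(canRL (addKr _)) => ->.
apply/eqP; rewrite addrC subr_eq; apply/eqP.
rewrite [x + z + x ∗ z - z]addrAC addrK [x + x ∗ z]addrC -!addrA; congr (_ + _).
by rewrite [RHS]addrC -!addrA.
Qed.

Lemma rmul0r x : 0 ∗ x = 0.
Proof. by apply: (@addrI _ (0 ∗ x)); rewrite -rmulDl !addr0. Qed.

Lemma rmulr0 x : x ∗ 0 = 0.
Proof. by apply: (@addrI _ (x ∗ 0)); rewrite -rmulDr !addr0. Qed.

Lemma rmulNr x y : (- x) ∗ y = - (x ∗ y).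
Proof. by apply/eqP; rewrite -addr_eq0 -rmulDl addNr rmul0r. Qed.

Lemma rmulrN x y : x ∗ (- y) = - (x ∗ y).
Proof. by apply/eqP; rewrite -addr_eq0 -rmulDr addNr rmulr0. Qed.

(** As [lam a b = a ∗ b + b], the action law [lam_circ] reduces to associativity after
    cancellation. *)
Lemma rmulA x y z : x ∗ (y ∗ z) = x ∗ y ∗ z.
Proof.
have lamE (a b : rsort R) : lam a b = a ∗ b + b :> rsort R.
  by rewrite rmulE; exact: lam_star.
have : x ∗ z + y ∗ z + x ∗ y ∗ z + z = x ∗ (y ∗ z) + x ∗ z + y ∗ z + z.
  by have := lam_circ x y z; rewrite !lamE rcircE !rmulDl rmulDr !addrA.
by move/addIr; rewrite -[RHS]addrA [RHS]addrC => /addrI.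
Qed.

Lemma rcircVb x : (cinv x : rsort R) + x + rmul (cinv x) x = 0.
Proof. by rewrite -rcircE circVb cone0. Qed.

Lemma rmulzl x y n : (x *~ n) ∗ y = (x ∗ y) *~ n.
Proof.
have mulnl k : (x *+ k) ∗ y = (x ∗ y) *+ k.
  by elim: k => [|k IH]; rewrite ?rmul0r // !mulrS rmulDl IH.
by case: n => k; rewrite ?NegzE ?mulrNz ?rmulNr -!pmulrn mulnl.
Qed.

Lemma rmulzr x y n : x ∗ (y *~ n) = (x ∗ y) *~ n.
Proof.
have mulnr k : x ∗ (y *+ k) = (x ∗ y) *+ k.
  by elim: k => [|k IH]; rewrite ?rmulr0 // !mulrS rmulDr IH.
by case: n => k; rewrite ?NegzE ?mulrNz ?rmulrN -!pmulrn mulnr.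
Qed.

End RadicalRing.

(** * Adjoining a unit: the Dorroh extension *)

Definition dorroh (R : radicalRing) : Type := (int * rsort R)%type.
HB.instance Definition _ (R : radicalRing) :=
  GRing.Zmodule.copy (dorroh R) (int * rsort R)%type.

Section Dorroh.
Variable R : radicalRing.
Local Open Scope ring_scope.

(** The pair [(m, x)] is to be read as the formal sum [m + x]. *)
Definition dmul (e f : dorroh R) : dorroh R :=
  (e.1 * f.1, f.2 *~ e.1 + e.2 *~ f.1 + e.2 ∗ f.2).

Fact dmulA : associative dmul.
Proof.
move=> [m x] [n y] [k z]; rewrite /dmul /=; congr pair; first exact: mulrA.
rewrite !(rmulDl, rmulDr, rmulzl, rmulzr) !mulrzDl !mulrzA rmulA.
rewrite [z *~ n *~ m]mulrzAC [y *~ k *~ m]mulrzAC !addrA.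
by rewrite [LHS](ACl (1*2*4*6*3*5*7)).
Qed.

Fact dmul1l : left_id (1, 0 : rsort R) dmul.
Proof. by move=> [m x]; rewrite /dmul /= mul1r mul0rz rmul0r !addr0. Qed.

Fact dmul1r : right_id (1, 0 : rsort R) dmul.
Proof. by move=> [m x]; rewrite /dmul /= mulr1 mul0rz rmulr0 addr0 add0r. Qed.

Fact dmulDl : left_distributive dmul +%R.
Proof.
move=> [m x] [n y] [k z]; rewrite /dmul /=; congr pair; first exact: mulrDl.
rewrite /= mulrzDr mulrzDl rmulDl.
by rewrite [LHS](AC (2*2*2) ((1*3*5)*(2*4*6))).
Qed.

Fact dmulDr : right_distributive dmul +%R.
Proof.
move=> [m x] [n y] [k z]; rewrite /dmul /=; congr pair; first exact: mulrDr.
rewrite /= mulrzDr mulrzDl rmulDr.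
by rewrite [LHS](AC (2*2*2) ((1*3*5)*(2*4*6))).
Qed.

Fact done_neq0 : (1, 0 : rsort R) != 0 :> dorroh R.
Proof. by apply/eqP => -[]. Qed.

HB.instance Definition _ := GRing.Zmodule_isNzRing.Build (dorroh R)
  dmulA dmul1l dmul1r dmulDl dmulDr done_neq0.

End Dorroh.

(** * Nilpotency from either maximum condition *)

Section RadicalNilpotent.
Variable R : radicalRing.
Implicit Types (x y r : rsort R) (e b : dorroh R).
Local Open Scope ring_scope.

(** The map [x ↦ 1 + x] embeds [(R, ∘)] in the units of the Dorroh extension. *)
Definition runit x : dorroh R := (1, x).
Definition rincl x : dorroh R := (0, x).
Definition drad : set (dorroh R) := [set e | e.1 = 0].

Lemma runitE x : runit x = 1 + rincl x.
Proof. by congr pair; rewrite ?addr0 ?add0r. Qed.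

Lemma rinclD x y : rincl (x + y) = rincl x + rincl y.
Proof. by congr pair; rewrite /= addr0. Qed.

Lemma rinclN x : rincl (- x) = - rincl x.
Proof. by congr pair; rewrite /= oppr0. Qed.

Lemma rinclM x y : rincl (x ∗ y) = rincl x * rincl y.
Proof. by congr pair; rewrite /= ?mulr0 // !mulr0z !add0r. Qed.

Lemma rincl_inj : injective rincl.
Proof. by move=> x y []. Qed.

Lemma runitM x y : runit (circ x y) = runit x * runit y.
Proof. by rewrite rcircE; congr pair; rewrite /= ?mulr1 // !mulr1z [x + y]addrC. Qed.

Lemma runit0 : runit 0 = 1. Proof. by []. Qed.

Lemma runitVr x : runit x * runit (cinv x) = 1.
Proof. by rewrite -runitM circbV cone0. Qed.

Lemma runitVl x : runit (cinv x) * runit x = 1.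
Proof. by rewrite -runitM circVb cone0. Qed.

Lemma dradE e : drad e -> e = rincl e.2.
Proof. by case: e => m x; rewrite /drad /= => ->. Qed.

Lemma drad_rincl x : drad (rincl x). Proof. by []. Qed.

Lemma dradMl e b : drad b -> drad (e * b).
Proof. by case: e b => [m x] [n y]; rewrite /drad /= => ->; apply: mulr0. Qed.

Lemma dradMr e b : drad e -> drad (e * b).
Proof. by case: e b => [m x] [n y]; rewrite /drad /= => ->; apply: mul0r. Qed.

Lemma drad_radical e : drad e -> exists f, f * (1 + e) = 1.
Proof. by move=> /dradE ->; exists (runit (cinv e.2)); rewrite -runitE runitVl. Qed.

(** Exponents are shifted, as [R] has no unit: this is the power of [x] with exponent [k + 1]. *)
Definition rpow x k : rsort R := iter k (rmul x) x.

Lemma rinclX x k : rincl x ^+ k.+1 = rincl (rpow x k).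
Proof. by elim: k => [|k IH]; rewrite ?expr1 // exprS IH -rinclM. Qed.

Definition rnil := forall x, exists k, rpow x k = 0.

Lemma rnil_of_sylvester_root : (forall b, drad b -> sylvester_root b) -> rnil.
Proof.
move=> Hroot x.
have [k xk] := rad_nilpotent dradMl drad_radical Hroot (drad_rincl x).
by exists k; apply: rincl_inj; rewrite -rinclX exprSr xk mul0r.
Qed.

(** The additive groups [b Z[b] (1 + b)^-n] ascend. Once they are stable, [b (1 + b)^-1] lies in [b
    Z[b]], which is the required relation with [u_0 = 1 + X]. *)
Lemma add_acc_rnil :
  acc (@between (add_group R) [set hzero R] setT) -> rnil.
Proof.
move=> accR; apply: rnil_of_sylvester_root => b Jb.
pose H n : set R :=
  [set r | exists f, rincl r * (1 + b) ^+ n = b * int_eval b f].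
have [n|n r|n stab] := accR H.
- split=> // [|_ ->]; last by exists 0; rewrite rmorph0 mulr0 mul0r.
  apply: (@subgroup_intro (add_group R)).
  + by exists 0; rewrite rmorph0 mulr0 mul0r.
  + move=> r s [f rf] [g sg]; exists (f + g).
    by rewrite [rincl _]rinclD mulrDl rf sg rmorphD mulrDr.
  + move=> r [f rf]; exists (- f).
    by rewrite [rincl _]rinclN mulNr rf rmorphN mulrN.
- move=> [f rf]; exists (f * (1 + 'X)).
  by rewrite exprSr mulrA rf rmorphM rmorphD rmorph1 /= int_evalX mulrA.
pose v := runit (cinv b.2).
have vb : v * (1 + b) = 1 by rewrite (dradE Jb) -runitE runitVl.
have bv : (1 + b) * v = 1 by rewrite (dradE Jb) -runitE runitVr.
have vbX k : v ^+ k * (1 + b) ^+ k = 1.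
  by rewrite -exprMn_comm ?vb ?expr1n // /GRing.comm vb bv.
have Jbv : drad (b * v ^+ n.+1) by apply: dradMr.
have [|f] := stab n.+1 (leqnSn n) (b * v ^+ n.+1).2.
  by exists 1; rewrite -(dradE Jbv) -mulrA vbX rmorph1.
rewrite -(dradE Jbv) exprS -!mulrA vbX mulr1 => bf.
exists 0%N, f; rewrite rmorphB rmorph1 [_ * f]mulrC rmorphM rmorphD rmorph1.
by rewrite /= int_evalX mulrBr mulrA -bf -mulrA vb subrr.
Qed.

Definition sylvester_prod n (e : nat -> nat) : {poly int} :=
  \prod_(i < n) (1 + sylvester 'X i) ^+ e i.

Lemma sylvester_prodM n (e f : nat -> nat) :
  sylvester_prod n (fun i => (e i + f i)%N) = sylvester_prod n e * sylvester_prod n f.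
Proof. by rewrite -big_split; apply: eq_bigr => i _; rewrite exprD. Qed.

Lemma sylvester_prod0 n : sylvester_prod n (fun=> 0%N) = 1.
Proof. by rewrite /sylvester_prod big1. Qed.

Lemma sylvester_prodS n (e : nat -> nat) k :
  sylvester_prod n.+1 (fun i => if i == n then k else e i) =
  sylvester_prod n e * (1 + sylvester 'X n) ^+ k.
Proof.
rewrite /sylvester_prod big_ord_recr /= eqxx; congr (_ * _).
by apply: eq_bigr => i _; rewrite ltn_eqF.
Qed.

Lemma comm_int_eval (E : nzRingType) (u b : E) f :
  GRing.comm u b -> GRing.comm u (int_eval b f).
Proof.
move=> ub; elim/poly_ind: f => [|f c IH]; first by rewrite rmorph0; apply: commr0.
rewrite rmorphD rmorphM /= int_evalX int_evalC; apply: commrD; first exact: commrM.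
exact: commr_int.
Qed.

(** [H n] holds the [r] such that [1 + r] commutes with [b] and is a quotient of monomials in the
    [u_i(b)], [i < n]. Stability puts [u_n(b)] among these quotients, and comaximality of [u_n] with
    the numerator gives the relation. *)
Lemma circ_acc_rnil :
  acc (@between (circ_group R) [set hzero R] setT) -> rnil.
Proof.
move=> accR; apply: rnil_of_sylvester_root => b Jb.
pose H n : set (rsort R) := [set r | GRing.comm (runit r) b /\ exists e f : nat -> nat,
  runit r * int_eval b (sylvester_prod n e) = int_eval b (sylvester_prod n f)].
have H0 n : H n (hzero R).
  split; first by rewrite runit0; apply/commr_sym/commr1.
  by exists (fun=> 0%N), (fun=> 0%N); rewrite runit0 mul1r.
have [n|n r|n stab] := accR H.
- split=> // [|_ -> //]; apply: circ_subgroup_intro => //.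
  + move=> r s [rb [e [f ref]]] [sb [e' [f' sef]]]; split.
      by rewrite runitM; apply/commr_sym/commrM; apply: commr_sym.
    exists (fun i => e i + e' i)%N, (fun i => f i + f' i)%N.
    rewrite !sylvester_prodM !rmorphM /= runitM -mulrA [runit s * _]mulrA.
    by rewrite (comm_int_eval _ sb) -mulrA sef mulrA ref.
  + move=> r [rb [e [f ref]]]; split.
      rewrite /GRing.comm -[LHS]mulr1 -(runitVr r) mulrA -[_ * b * _]mulrA -rb.
      by rewrite mulrA runitVl mul1r.
    by exists f, e; rewrite -ref mulrA runitVl mul1r.
- move=> [rb [e [f ref]]]; split=> //.
  exists (fun i => if i == n then 0%N else e i), (fun i => if i == n then 0%N else f i).
  by rewrite !sylvester_prodS !mulr1.
have wE : sylvester b n = int_eval b (sylvester 'X n).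
  by rewrite rmorph_sylvester /= int_evalX.
have Jw : drad (sylvester b n) by elim: n {stab wE} => //= n IH; apply: dradMr.
have rE : runit (sylvester b n).2 = int_eval b (1 + sylvester 'X n).
  by rewrite runitE -(dradE Jw) wE rmorphD rmorph1.
have [|_ [e [f]]] := stab n.+1 (leqnSn n) (sylvester b n).2.
  split; first by rewrite rE; apply/commr_sym/comm_int_eval.
  (* The constant conditional gives the exponents the shape expected by [sylvester_prodS]. *)
  exists (fun i => if i == n then 0%N else 0%N), (fun i => if i == n then 1%N else 0%N).
  by rewrite !sylvester_prodS !sylvester_prod0 !mulr1 rmorph1 mulr1 mul1r rE.
rewrite rE -rmorphM => uXY.
have [a [c acE]] := sylvester_comaximal ('X : {poly int}) f n.
(* In the identity [a * u + c * sylvester_prod n f = 1], the numerator may be replaced at [b] by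
   [u * sylvester_prod n e]. *)
exists n, (a + c * sylvester_prod n e); set u := 1 + _ in uXY acE *.
have -> : u * (a + c * sylvester_prod n e) - 1 =
    c * (u * sylvester_prod n e - sylvester_prod n f) +
    (a * u + c * sylvester_prod n f - 1) by ring.
by rewrite {2}/sylvester_prod acE subrr addr0 rmorphM rmorphB /= uXY subrr !mulr0.
Qed.

End RadicalNilpotent.

(** * Ideals *)

Section Levitzki.
Variable R : radicalRing.
Implicit Types (x y r s : rsort R) (I J L : set (rsort R)).
Local Open Scope ring_scope.

Definition left_ideal L := [/\ L 0, forall x y, L x -> L y -> L (x - y) &
  forall x y, L y -> L (x ∗ y)].

Definition ideal I := left_ideal I /\ forall x y, I x -> I (x ∗ y).

Lemma left_ideal_add L : left_ideal L -> @is_subgroup (add_group R) L.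
Proof. by case=> L0 LB _; apply/(@is_subgroupP (add_group R)). Qed.

Lemma left_idealN L x : left_ideal L -> L x -> L (- x).
Proof. by case=> L0 LB _ Lx; rewrite -sub0r; apply: LB. Qed.

Lemma left_idealD L x y : left_ideal L -> L x -> L y -> L (x + y).
Proof.
move=> lL Lx Ly; rewrite -[y]opprK; case: (lL) => _ + _; apply=> //.
exact: left_idealN.
Qed.

(** Inverses stay in [L] because [cinv x = - (x + cinv x ∗ x)]. This lets the condition on [(R, ∘)]
    bound the left ideals. *)
Lemma left_ideal_circ L : left_ideal L -> @is_subgroup (circ_group R) L.
Proof.
move=> lL; have [L0 LB LM] := lL; apply: circ_subgroup_intro => // [x y Lx Ly|x Lx].
  by rewrite rcircE; do !apply: left_idealD => //; apply: LM.
have /eqP := rcircVb x; rewrite -addrA addr_eq0 => /eqP ->.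
by apply: left_idealN => //; apply: left_idealD => //; apply: LM.
Qed.

Lemma annihilator_left_ideal I x : ideal I -> left_ideal [set s | I (s ∗ x)].
Proof.
case=> -[I0 IB IM] _; split=> /= [|s t sx tx|s t tx].
- by rewrite rmul0r.
- by rewrite rmulDl rmulNr; apply: IB.
- by rewrite -rmulA; apply: IM.
Qed.

(* Utumi's argument: an [x] outside [I] whose left annihilator modulo [I] is
   maximal satisfies x R x <= I, since the annihilators of x and of (x r)^k
   agree as long as (x r)^k is not in [I]. *)
Lemma exists_sandwich I : acc left_ideal -> rnil R -> ideal I -> ~ I = setT ->
  exists2 x, ~ I x & forall r, I (x ∗ r ∗ x).
Proof.
move=> accR nilR iI nT; have [[I0 IB IMl] IMr] := iI.
have [x0 Ix0] : exists x, ~ I x.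
  apply: contrapT => nx; apply: nT; apply/seteqP; split=> // x _.
  by apply: contrapT => Ix; apply: nx; exists x.
pose F : set (set (rsort R)) := [set L | exists2 x, ~ I x & L = [set s | I (s ∗ x)]].
have [||_ [x Ix ->] maxx] := @acc_max _ left_ideal F [set s | I (s ∗ x0)] accR.
- by move=> _ [x _ ->]; apply: annihilator_left_ideal.
- by exists x0.
exists x => // r; have [Ixr|Ixr] := pselect (I (x ∗ r)); first exact: IMr.
have [k Ik Iks] : exists2 k, ~ I (rpow (x ∗ r) k) & I (rpow (x ∗ r) k.+1).
  apply: contrapT => nk; have [k xr0] := nilR (x ∗ r).
  have : ~ I (rpow (x ∗ r) k).
    elim: {xr0} k => //= k IH Ik; apply: nk; exists k => //.
  by rewrite xr0.
have powE : exists w, rpow (x ∗ r) k = x ∗ w.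
  by case: (k) => [|m]; [exists r | exists (r ∗ rpow (x ∗ r) m); rewrite rmulA].
(* Modulo [I], [x ∗ r] kills [rpow (x ∗ r) k], hence kills [x] by maximality. *)
apply: (maxx [set s | I (s ∗ rpow (x ∗ r) k)]) => //.
  by exists (rpow (x ∗ r) k).
by move=> s /= sx; have [w ->] := powE; rewrite rmulA; apply: IMr.
Qed.

(** If [x ∗ R] lies in [I], take the [y] with [y ∗ R] in [I]. Otherwise take, in the right
    annihilator of [x ∗ R] modulo [I], the elements that kill this annihilator from the left; every
    [x ∗ r] is one, by the sandwich property. *)
Lemma exists_square_zero I : acc left_ideal -> rnil R -> ideal I -> ~ I = setT ->
  exists J, [/\ ideal J, I `<=` J, ~ J `<=` I & forall x y, J x -> J y -> I (x ∗ y)].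
Proof.
move=> accR nilR iI nT; have [x Ix xRx] := exists_sandwich accR nilR iI nT.
have [[I0 IB IMl] IMr] := iI.
have [xR|/existsNP[r xr]] := pselect (forall r, I (x ∗ r)).
  exists [set y | forall r, I (y ∗ r)]; split=> //=.
  - split; first split=> [r|y z Iy Iz r|y z Iz r] /=.
    + by rewrite rmul0r.
    + by rewrite rmulDl rmulNr; apply: IB.
    + by rewrite -rmulA; apply: IMl.
    + by move=> y z Iy r /=; rewrite -rmulA; apply: Iy.
  - by move=> y Iy r; apply: IMr.
  - by move=> /(_ x xR).
pose J y := forall r, I (x ∗ r ∗ y).
have JMl y z : J z -> J (y ∗ z) by move=> Jz s; rewrite rmulA -[_ ∗ y]rmulA.
have JMr y z : J y -> J (y ∗ z) by move=> Jy s; rewrite rmulA; apply: IMr.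
exists [set y | J y /\ forall j, J j -> I (y ∗ j)]; split=> //=.
- split; first split=> [|y z [Jy Iy] [Jz Iz]|y z [Jz Iz]] /=.
  + by split=> [s|j _]; rewrite ?rmulr0 ?rmul0r.
  + split=> [s|j Jj]; first by rewrite rmulDr rmulrN; apply: IB; [apply: Jy|apply: Jz].
    by rewrite rmulDl rmulNr; apply: IB; [apply: Iy|apply: Iz].
  + by split=> [|j Jj]; [apply: JMl | rewrite -rmulA; apply/IMl/Iz].
  + by move=> y z [Jy Iy]; split=> [|j Jj]; [apply: JMr | rewrite -rmulA; apply/Iy/JMl].
- by move=> y Iy; split=> [s|j _]; [apply: IMl | apply: IMr].
- move=> sub; apply/xr/sub; split; last by move=> j; apply.
  by apply: JMr => s; apply: xRx.
- by move=> y z [_ Iy] [Jz _]; apply: Iy.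
Qed.

Lemma ideal_induction (Q : set (rsort R) -> Prop) :
    acc left_ideal -> rnil R -> Q [set 0] ->
    (forall I J, ideal I -> ideal J -> I `<=` J ->
      (forall x y, J x -> J y -> I (x ∗ y)) -> Q I -> Q J) ->
  Q setT.
Proof.
move=> accR nilR Q0 QS.
have [||I [iI QI] maxI] := @acc_max _ left_ideal [set I | ideal I /\ Q I] [set 0] accR.
- by move=> I [[]].
- split=> //; split; first split=> //.
  + by move=> x y -> ->; rewrite subr0.
  + by move=> x y ->; rewrite rmulr0.
  + by move=> x y ->; rewrite rmul0r.
have [<- //|nT] := pselect (I = setT).
have [J [iJ IJ nJI JJI]] := exists_square_zero accR nilR iI nT.
by case: nJI; apply: maxI => //; split=> //; apply: QS QI.
Qed.

End Levitzki.

(** * Ideals of skew braces *)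

HB.lock Definition mu (A : skewBrace) (c a : A) : A :=
  (a ∘ c - c)%brace.

Section BraceIdeals.
Variable A : skewBrace.
Implicit Types (a b c d x y : A) (H N M : set A).
Local Open Scope brace_scope.

Lemma muE c a : mu c a = a ∘ c - c.
Proof. by rewrite mu.unlock. Qed.

Lemma mu_star a c : mu c a = a + star a c.
Proof. by rewrite muE circE_star haddK. Qed.

(** Closure under [mu] stands in for normality in [(A, ∘)], which [brace_ideal_circ_normal] recovers
    in the two-sided case. *)
Definition brace_ideal N := [/\ @is_subgroup (add_group A) N,
  forall a x, N x -> N (a + x - a), forall a x, N x -> N (lam a x) &
  forall a x, N x -> N (mu a x)].

Lemma lam_inv x : lam (cinv x) (- x) = cinv x.
Proof.
have := add_circ x (- x); rewrite haddbN -cone0 => /esym E.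
by rewrite -[LHS]circ1b -(circVb x) -circA E circb1.
Qed.

Lemma brace_ideal_circ N : brace_ideal N -> @is_subgroup (circ_group A) N.
Proof.
move=> [sN _ lN _]; apply: circ_subgroup_intro.
- exact: subgroup1 sN.
- move=> x y Nx Ny; rewrite circE; apply: (@subgroupM (add_group A)) => //.
  exact: lN.
- move=> x Nx; rewrite -lam_inv; apply: (lN).
  exact: (@subgroupV (add_group A) N x sN Nx).
Qed.

Hypothesis hA : two_sided A.

(** [mu] mirrors [lam] on the right, and its additivity is the two-sided law. *)
Lemma muD c a b : mu c (a + b) = mu c a + mu c b.
Proof. by rewrite !muE hA !haddA. Qed.

Lemma mu_circ a b c : mu c (mu b a) = mu (b ∘ c) a.
Proof.
rewrite (muE b a) muD; have -> : mu c (- b) = - mu c b.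
  apply: (@haddI _ (mu c b)); rewrite -muD !haddbN muE.
  by rewrite -[X in X ∘ c]cone0 circ1b haddbN.
by rewrite !muE hoppD hoppK !haddA haddNK circA.
Qed.

Lemma mu1 a : mu (cone A) a = a.
Proof. by rewrite !muE circb1 -{1}(haddb0 a) cone0 haddK. Qed.

Lemma muKV c a : mu c (mu (cinv c) a) = a.
Proof. by rewrite mu_circ circVb mu1. Qed.

(** [mu m] sends the conjugate to [m ∘ x - m], an additive conjugate of [lam m x]; then
    [mu (cinv m)] leads back within [N]. *)
Lemma brace_ideal_circ_normal N m x : brace_ideal N -> N x -> N (m ∘ x ∘ cinv m).
Proof.
move=> [sN nN lN mN] Nx; rewrite -[X in N X](muKV (cinv m)); apply: (mN).
have -> : cinv (cinv m) = m by exact: (@invgK (circ_group A)).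
rewrite !muE -circA circVb circb1 circE; exact/nN/lN.
Qed.

(** Between [N] and [M] both groups have the same subgroups, so there the condition is borrowed from
    [(A, ∘)]. *)
Lemma brace_ideal_add_acc (rev : bool) N M :
    brace_ideal N -> brace_ideal M -> N `<=` M ->
    (forall b c, M b -> M c ->
       exists2 n, N n & b ∘ c = (if rev then c + b else b + c) + n) ->
    acc (@between (circ_group A) [set 0] setT) ->
  acc (@between (add_group A) [set 0] N) -> acc (@between (add_group A) [set 0] M).
Proof.
move=> iN iM NM near accC accN; have [sN nN lN _] := iN; have [sM _ _ _] := iM.
have N0 : [set hzero A] `<=` N by move=> _ ->; apply: subgroup1 sN.
apply: (@acc_extension (add_group A) _ N M) => //; first by move=> m x _; apply: nN.
rewrite (between_add_circ sN lN sM (brace_ideal_circ iM) near).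
by apply: acc_sub accC; apply: between_sub.
Qed.

Lemma brace_ideal_circ_acc (rev : bool) N M :
    brace_ideal N -> brace_ideal M -> N `<=` M ->
    (forall b c, M b -> M c ->
       exists2 n, N n & b ∘ c = (if rev then c + b else b + c) + n) ->
    acc (@between (add_group A) [set 0] setT) ->
  acc (@between (circ_group A) [set 0] N) -> acc (@between (circ_group A) [set 0] M).
Proof.
move=> iN iM NM near accC accN; have [sN nN lN _] := iN; have [sM _ _ _] := iM.
have N0 : [set hzero A] `<=` N by move=> _ ->; apply: subgroup1 sN.
apply: (@acc_extension (circ_group A) _ N M) => //.
- exact: brace_ideal_circ.
- exact: brace_ideal_circ.
- by move=> m x _; apply: brace_ideal_circ_normal.
rewrite -(between_add_circ sN lN sM (brace_ideal_circ iM) near).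
by apply: acc_sub accC; apply: between_sub.
Qed.

End BraceIdeals.

(** * The equivalence for radical rings *)

Section RadicalAcc.
Variable R : radicalRing.
Implicit Types (x y : rsort R) (I J : set (rsort R)).
Local Open Scope ring_scope.

Lemma ideal_brace_ideal I : ideal I -> brace_ideal (A := R) I.
Proof.
move=> [lI IM]; have [I0 IB IMl] := lI; split; first exact: left_ideal_add.
- by move=> a x Ix; rewrite raddC haddKl.
- move=> a x Ix; rewrite lam_star; apply: (left_idealD lI) => //.
  by rewrite -rmulE; apply: IMl.
- move=> a x Ix; rewrite mu_star; apply: (left_idealD lI) => //.
  by rewrite -rmulE; apply: IM.
Qed.

Lemma square_near I J : (forall x y, J x -> J y -> I (x ∗ y)) ->
  forall x y, J x -> J y ->
  exists2 n, I n & circ x y = hadd (if false then hadd y x else hadd x y) n.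
Proof. by move=> JJ x y Jx Jy; exists (x ∗ y); [apply: JJ | rewrite rcircE]. Qed.

Lemma acc_between1 (G : groupType) : acc (@between G [set 1%g] [set 1%g]).
Proof.
by move=> H PH _; exists 0%N => m _ x; case: (PH m) (PH 0%N) => _ _ Hm [_ H0 _] /Hm /H0.
Qed.

Lemma radical_acc :
  acc (@between (add_group R) [set hzero R] setT) <->
  acc (@between (circ_group R) [set hzero R] setT).
Proof.
split=> accR.
  apply: (@ideal_induction R (fun I => acc (@between (circ_group R) [set hzero R] I))).
  - apply: acc_sub accR => L lL; split=> //; first exact: left_ideal_add.
    by move=> _ ->; case: lL.
  - exact: add_acc_rnil.
  - by rewrite -[X in [set X]](@cone0 R); apply: acc_between1.
  - move=> I J iI iJ IJ JJ; apply: (@brace_ideal_circ_acc R (@rtwo_sided R) false) => //.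
    + exact: ideal_brace_ideal.
    + exact: ideal_brace_ideal.
    + exact: square_near.
apply: (@ideal_induction R (fun I => acc (@between (add_group R) [set hzero R] I))).
- apply: acc_sub accR => L lL; split=> //; first exact: left_ideal_circ.
  by move=> _ ->; case: lL.
- exact: circ_acc_rnil.
- exact: acc_between1.
- move=> I J iI iJ IJ JJ; apply: (@brace_ideal_add_acc R false) => //.
  + exact: ideal_brace_ideal.
  + exact: ideal_brace_ideal.
  + exact: square_near.
Qed.

End RadicalAcc.

(** * Two-sided skew braces *)

Section Transport.
Variables (G G' : groupType) (f : G -> G').
Hypotheses (fM : {morph f : x y / (x * y)%g}) (f_inj : injective f).
Local Open Scope group_scope.

Lemma inj_morph1 : f 1 = 1.
Proof. by apply: (@mulgI _ (f 1)); rewrite -fM !mulg1. Qed.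

Lemma inj_morphV x : f x^-1 = (f x)^-1.
Proof. by apply: (@mulgI _ (f x)); rewrite -fM !mulgV inj_morph1. Qed.

Lemma acc_between_inj :
  acc (@between G [set 1] setT) <-> acc (@between G' [set 1] (range f)).
Proof.
split=> accG H PH Hs.
  have [n|n|n st] := accG (fun n => f @^-1` H n).
  - have [sH _ _] := PH n; split=> //.
      apply: subgroup_intro; rewrite /preimage /=.
      + by rewrite inj_morph1; apply: subgroup1.
      + by move=> x y; rewrite fM; apply: subgroupM.
      + by move=> x; rewrite inj_morphV; apply: subgroupV.
    by move=> _ ->; rewrite /preimage /= inj_morph1; apply: subgroup1.
  - by move=> x; apply: Hs.
  - exists n => m nm y Hy; case: (PH m) => _ _ /(_ y Hy)[x _ xy].
    by rewrite -xy; apply: (st m nm); rewrite /preimage /= xy.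
have [n|n|n st] := accG (fun n => f @` H n).
- have [sH _ _] := PH n; split.
  + apply: subgroup_intro.
    * by exists 1; [apply: subgroup1 | apply: inj_morph1].
    * move=> _ _ [x Hx <-] [y Hy <-]; exists (x * y); last exact: fM.
      exact: subgroupM.
    * move=> _ [x Hx <-]; exists x^-1; last exact: inj_morphV.
      exact: subgroupV.
  + by move=> _ ->; exists 1; [apply: subgroup1 | apply: inj_morph1].
  + by move=> _ [x _ <-]; exists x.
- by move=> _ [x Hx <-]; exists x => //; apply: Hs.
- exists n => m nm x Hx; have [|y Hy /f_inj <- //] := st m nm (f x).
  by exists x.
Qed.

End Transport.

(** * Ideals as skew braces in their own right *)

Section SubBrace.
Variables (A : skewBrace) (N : set A).
Hypotheses (iN : brace_ideal N).
Local Open Scope brace_scope.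

Lemma mem_zero : hzero A \in N.
Proof. by case: iN => sN _ _ _; rewrite inE; apply: subgroup1 sN. Qed.

Lemma mem_opp (x : N) : - val x \in N.
Proof.
case: iN => sN _ _ _; rewrite inE; apply: (@subgroupV (add_group A)) => //.
by rewrite -in_setE; apply: valP.
Qed.

Lemma mem_add (x y : N) : val x + val y \in N.
Proof.
by case: iN => sN _ _ _; rewrite inE; apply: (@subgroupM (add_group A));
  rewrite // -in_setE; apply: valP.
Qed.

Lemma mem_one : cone A \in N.
Proof. by rewrite cone0 mem_zero. Qed.

Lemma mem_cinv (x : N) : cinv (val x) \in N.
Proof.
rewrite inE; apply: (@subgroupV (circ_group A) _ _ (brace_ideal_circ iN)).
by rewrite -in_setE; apply: valP.
Qed.

Lemma mem_circ (x y : N) : val x ∘ val y \in N.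
Proof.
by rewrite inE; apply: (@subgroupM (circ_group A) _ _ _ (brace_ideal_circ iN));
  rewrite -in_setE; apply: valP.
Qed.

Definition sub_brace : skewBrace.
Proof.
pose sub (x : A) (Nx : x \in N) : N := exist _ x Nx.
refine (@SkewBrace N (sub _ mem_zero) (fun x => sub _ (mem_opp x))
  (fun x y => sub _ (mem_add x y)) _ _ _ _ _ (sub _ mem_one)
  (fun x => sub _ (mem_cinv x)) (fun x y => sub _ (mem_circ x y)) _ _ _ _ _ _).
- by move=> x y z; apply: val_inj; apply: haddA.
- by move=> x; apply: val_inj; apply: hadd0b.
- by move=> x; apply: val_inj; apply: haddb0.
- by move=> x; apply: val_inj; apply: haddNb.
- by move=> x; apply: val_inj; apply: haddbN.
- by move=> x y z; apply: val_inj; apply: circA.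
- by move=> x; apply: val_inj; apply: circ1b.
- by move=> x; apply: val_inj; apply: circb1.
- by move=> x; apply: val_inj; apply: circVb.
- by move=> x; apply: val_inj; apply: circbV.
- by move=> x y z; apply: val_inj; apply: circDr.
Defined.

Lemma sub_brace_add_acc : acc (@between (add_group sub_brace) [set 0] setT) <->
  acc (@between (add_group A) [set 0] N).
Proof.
have <- : range (val : N -> A) = N.
  apply/seteqP; split=> [_ [x _ <-]|x Nx]; first by rewrite -in_setE; apply: valP.
  by move/mem_set: Nx => Nx; exists (exist _ x Nx).
apply: (@acc_between_inj (add_group sub_brace) (add_group A) val) => //.
exact: val_inj.
Qed.

Lemma sub_brace_circ_acc : acc (@between (circ_group sub_brace) [set 0] setT) <->
  acc (@between (circ_group A) [set 0] N).
Proof.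
have <- : range (val : N -> A) = N.
  apply/seteqP; split=> [_ [x _ <-]|x Nx]; first by rewrite -in_setE; apply: valP.
  by move/mem_set: Nx => Nx; exists (exist _ x Nx).
rewrite -!cone0.
apply: (@acc_between_inj (circ_group sub_brace) (circ_group A) val) => //.
exact: val_inj.
Qed.

End SubBrace.

(** * The ideals [S] and [C], and the general case *)

Section TwoSided.
Variable A : skewBrace.
Hypothesis hA : two_sided A.
Implicit Types (a b c d x y z : A).
Local Open Scope brace_scope.

(** The map [a ↦ a + star a c] is [mu c], hence additive. *)
Lemma starDl a b c : star (a + b) c = - b + star a c + b + star b c.
Proof.
apply: (@haddI _ (a + b)); rewrite -mu_star muD // !mu_star.
by rewrite !haddA haddK.
Qed.

(* Obtained by expanding [star (a + b) (c + d)] in the two possible orders. *)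
Lemma star_commute a b c d :
  (- c + b ∘ c - b) + star a d = star a d + (- c + b ∘ c - b).
Proof.
have E := starDr (a + b) c d; rewrite starDl !starDr !(starDl a b) in E.
have {}E : b ∘ c - b + star a d + b = c + star a d - c + b ∘ c.
  rewrite !circE_star; symmetry.
  apply: (@haddI _ (- b + star a c)); apply: (@haddIr _ (star b d - c)).
  by move: E; rewrite !haddA.
apply: (@haddI _ c); apply: (@haddIr _ b).
by rewrite !haddA haddNK haddbN hadd0b -E.
Qed.

Definition star_square : set A := [set x | forall H : set A,
  @is_subgroup (add_group A) H -> (forall a b, H (star a b)) -> H x].

Lemma star_square_star a b : star_square (star a b).
Proof. by move=> H _; apply. Qed.

Lemma star_square_subgroup : @is_subgroup (add_group A) star_square.
Proof.
apply: (@subgroup_intro (add_group A)).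
- by move=> H sH _; apply: subgroup1 sH.
- by move=> x y Sx Sy H sH HS; apply: (@subgroupM (add_group A)); [|apply: Sx|apply: Sy].
- by move=> x Sx H sH HS; apply: (@subgroupV (add_group A)); [|apply: Sx].
Qed.

Lemma star_squareD x y : star_square x -> star_square y -> star_square (x + y).
Proof. exact: subgroupM star_square_subgroup. Qed.

Lemma star_squareN x : star_square x -> star_square (- x).
Proof. exact: subgroupV star_square_subgroup. Qed.

Lemma star_square_normal g x : star_square x -> star_square (g + x - g).
Proof.
move=> Sx; apply: (Sx [set x | forall g, star_square (g + x - g)]) => [|a c h] /=.
  apply: (@subgroup_intro (add_group A)) => /=.
  - move=> h; rewrite -[X in _ X]/(h + 0 - h) haddb0 haddbN.
    exact: subgroup1 star_square_subgroup.
  - move=> y z Sy Sz h; rewrite -[X in _ X]/(h + (y + z) - h).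
    have -> : h + (y + z) - h = (h + y - h) + (h + z - h) by rewrite !haddA haddNK.
    by apply: star_squareD.
  - move=> y Sy h; rewrite -[X in _ X]/(h + - y - h).
    have -> : h + - y - h = - (h + y - h) by rewrite !hoppD hoppK haddA.
    exact: star_squareN.
(* By [starDr], a conjugate of a generator is a difference of generators. *)
have -> : h + star a c - h = - star a h + star a (h + c) by rewrite starDr haddKl.
by apply: star_squareD; [apply: star_squareN|]; apply: star_square_star.
Qed.

Lemma star_square_ideal : brace_ideal star_square.
Proof.
split; first exact: star_square_subgroup.
- exact: star_square_normal.
- by move=> a x Sx; rewrite lam_star; apply: star_squareD => //; apply: star_square_star.
- by move=> a x Sx; rewrite mu_star; apply: star_squareD => //; apply: star_square_star.
Qed.

Lemma star_square_near x y : exists2 n, star_square n & x ∘ y = x + y + n.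
Proof.
exists (- y + star x y + y); last by rewrite circE_star !haddA haddK.
have := star_square_normal (- y) (star_square_star x y).
by rewrite hoppK.
Qed.

Definition square_center : set A :=
  [set z | star_square z /\ forall x, star_square x -> z + x = x + z].

(** Automorphisms of [S] preserve its centre; this serves for conjugations, [lam a] and [mu a]
    alike. *)
Lemma square_center_auto (f g : A -> A) : {morph f : x y / x + y} -> cancel g f ->
    (forall x, star_square x -> star_square (f x)) ->
    (forall x, star_square x -> star_square (g x)) ->
  forall z, square_center z -> square_center (f z).
Proof.
move=> fD fg Sf Sg z [Sz zC]; split=> [|x Sx]; first exact: Sf.
by rewrite -(fg x) -!fD zC //; apply: Sg.
Qed.

Lemma square_center_ideal : brace_ideal square_center.
Proof.
have [sS nS lS mS] := star_square_ideal.
split.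
- apply: (@subgroup_intro (add_group A)).
  + split=> [|x _]; first exact: subgroup1 sS.
    by rewrite -[LHS]/(0 + x) hadd0b -[RHS]/(x + 0) haddb0.
  + move=> x y [Sx xC] [Sy yC]; split=> [|z Sz]; first exact: star_squareD.
    by rewrite -[LHS]/(x + y + z) -[RHS]/(z + (x + y)) -haddA yC // !haddA xC.
  + move=> x [Sx xC]; split=> [|z Sz]; first exact: star_squareN.
    rewrite -[LHS]/(- x + z) -[RHS]/(z - x); apply: (@haddI _ x); apply: (@haddIr _ x).
    by rewrite haddNKl !haddA haddNK xC.
- move=> a; apply: (@square_center_auto (fun x => a + x - a) (fun x => - a + x - - a)).
  + by move=> x y; rewrite !haddA haddNK.
  + by move=> x; rewrite hoppK !haddA haddbN hadd0b haddK.
  + exact: nS.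
  + by move=> x; apply: nS.
- move=> a; apply: (@square_center_auto (lam a) (lam (cinv a))).
  + exact: lamD.
  + exact: lamKV.
  + exact: lS.
  + exact: lS.
- move=> a; apply: (@square_center_auto (mu a) (mu (cinv a))).
  + by move=> x y; apply: muD.
  + by move=> x; apply: muKV.
  + exact: mS.
  + exact: mS.
Qed.

(** The element [- c + b ∘ c - b] lies in [S] and, by [star_commute], commutes with the generators
    of [S]; so it is central and can be moved to the right end. *)
Lemma square_center_near b c : star_square b -> star_square c ->
  exists2 n, square_center n & b ∘ c = c + b + n.
Proof.
move=> Sb Sc; have [w [Sw wb wS]] : exists w, [/\ star_square w,
    w + b = - c + b ∘ c & forall a d, w + star a d = star a d + w].
  exists (- c + b ∘ c - b); split; last by move=> a d; apply: star_commute.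
    apply: star_squareD (star_squareN Sb); apply: star_squareD (star_squareN Sc) _.
    exact: (@subgroupM (circ_group A) _ _ _ (brace_ideal_circ star_square_ideal)).
  by rewrite haddNK.
have wC x : star_square x -> w + x = x + w.
  move=> Sx; apply: (Sx [set x | w + x = x + w]) => [|a d /=]; last first.
    exact: wS.
  apply: (@subgroup_intro (add_group A)) => /=.
  - by rewrite -[LHS]/(w + 0) haddb0 -[RHS]/(0 + w) hadd0b.
  - move=> y z yC zC; rewrite -[LHS]/(w + (y + z)) -[RHS]/(y + z + w).
    by rewrite haddA yC -!haddA zC.
  - move=> y yC; rewrite -[LHS]/(w - y) -[RHS]/(- y + w).
    apply: (@haddI _ y); apply: (@haddIr _ y).
    by rewrite haddNKl !haddA haddNK yC.
exists w; last by rewrite -haddA -wC // wb haddNKl.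
by split.
Qed.

Definition square_center_ring : radicalRing.
Proof.
refine (@RadicalRing (sub_brace square_center_ideal) _ _).
- move=> x y; apply: val_inj => /=.
  have [_ xC] : square_center (val x) by rewrite -in_setE; apply: valP.
  by apply: xC; have [] : square_center (val y) by rewrite -in_setE; apply: valP.
- by move=> x y z; apply: val_inj; apply: hA.
Defined.

Lemma square_center_acc : acc (@between (add_group A) [set 0] square_center) <->
  acc (@between (circ_group A) [set 0] square_center).
Proof.
apply: iff_trans (iff_sym (sub_brace_add_acc square_center_ideal)) _.
apply: iff_trans _ (sub_brace_circ_acc square_center_ideal).
exact: (radical_acc square_center_ring).
Qed.

Lemma setT_ideal : brace_ideal [set: A].
Proof. by split=> //; apply: (@subgroup_intro (add_group A)). Qed.

Lemma two_sided_acc : acc (@between (add_group A) [set 0] setT) <->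
  acc (@between (circ_group A) [set 0] setT).
Proof.
have iS := star_square_ideal; have iZ := square_center_ideal.
have ZS : square_center `<=` star_square by move=> x [].
split=> accA.
  apply: (brace_ideal_circ_acc (rev := false) hA iS setT_ideal) => //.
    by move=> b c _ _; apply: star_square_near.
  (* On [S] modulo [C], [∘] is the opposite of addition. *)
  apply: (brace_ideal_circ_acc (rev := true) hA iZ iS) => //.
    exact: square_center_near.
  by apply/square_center_acc; apply: acc_sub accA; apply: between_sub.
apply: (brace_ideal_add_acc (rev := false) iS setT_ideal) => //.
  by move=> b c _ _; apply: star_square_near.
apply: (brace_ideal_add_acc (rev := true) iZ iS) => //.
  exact: square_center_near.
by apply/square_center_acc; apply: acc_sub accA; apply: between_sub.
Qed.

End TwoSided.

Theorem theorem4p17 (A : skewBrace) (hA : two_sided A) :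
  max_subgroups (add_group A) <-> max_subgroups (circ_group A).
Proof.
apply: iff_trans (max_subgroupsE _) _.
apply: iff_trans _ (iff_sym (max_subgroupsE _)).
have := two_sided_acc hA; rewrite -[X in _ <-> acc (between [set X] _)]cone0; exact.
Qed.
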